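(* Let $p>q\ge1$ with $p<\infty$, and let $T$ be a linear operator from $L^p(\mathfrak X)$ into the space of functions from $\mathfrak X$ to $\mathbb C$. If $T$ is a $(p,q)$-weak operator, with constant $C>0$ in the weak type inequality, then $T:L^p(\mathfrak X)\to L^p(\mathfrak X)$ is bounded. Moreover, $$\|T\|_{B(L^p(\mathfrak X))}\le 2^{\frac{p-q}{p}}\,C\left(\frac{p}{p-q}\right)^{\frac1p}.$$
   Context: $\mathfrak X$ is (the vertex set of) a homogeneous tree of degree $\kappa+1$, $\kappa\ge2$ an integer: a connected graph without loops (cycles) in which every vertex has exactly $\kappa+1$ neighbours. It carries the counting measure $\vartheta$, and $L^p(\mathfrak X)$ is taken with respect to $\vartheta$. A linear operator $T$ from $L^p(\mathfrak X)$ into the functions $\mathfrak X\to\mathbb C$ is a $(p,q)$-weak operator ($1\le q<\infty$) if there is $C>0$ such that for all $f\in L^p(\mathfrak X)$ and all $\lambda>0$, $$\vartheta(\{x\in\mathfrak X:|Tf(x)|>\lambda\})\le\left(C\,\frac{\|f\|_{L^p(\mathfrak X)}}{\lambda}\right)^q.$$ *)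

(* Defs.v *)
From HB Require Import structures.
From mathcomp Require Import all_boot all_order all_algebra.
From mathcomp Require Import all_classical all_reals all_analysis.
From mathcomp Require Export complex.
Export Order.TTheory GRing.Theory Num.Theory.
Export numFieldNormedType.Exports.

Set Implicit Arguments.
Unset Strict Implicit.
Unset Printing Implicit Defensive.

Local Open Scope classical_set_scope.
Local Open Scope ring_scope.

(* [ucycle] of length at least 3 is a simple closed path; in a simple graph
   shorter ones ([x], [x; y]) are degenerate and are not graph cycles. *)
Record homogeneous_tree (X : choiceType) (adj : rel X) (kappa : nat) : Prop :=
  HomogeneousTree {
    htree_sym : symmetric adj;
    htree_irr : irreflexive adj;
    htree_connected : forall x y : X, exists2 s : seq X,
      path adj x s & last x s = y;
    htree_acyclic : forall c : seq X, (2 < size c)%N -> ~ ucycle adj c;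
    htree_degree : forall x : X, ([set y | adj x y] #= `I_kappa.+1)%card }.

(* A copy of X carrying the sigma-algebra of all subsets. The library requires
   measurable types to be pointed; on a tree this only says it is nonempty. *)
Definition vertices (X : Type) : Type := X.

HB.instance Definition _ (X : pointedType) := Pointed.on (vertices X).

HB.instance Definition _ (X : pointedType) :=
  @isMeasurable.Build default_measure_display (vertices X)
    (@discrete_measurable X) (@discrete_measurable0 X)
    (@discrete_measurableC X) (@discrete_measurableU X).

Section LpCounting.
Context {R : realType} {X : pointedType}.
Implicit Types (p q : R) (f : X -> R[i]) (T : (X -> R[i]) -> (X -> R[i])).

Definition modulus (z : R[i]) : R := Normc.normc z.

Definition Lp_norm p f : \bar R :=
  'N[@counting (vertices X) R]_(p%:E)[(fun x => (modulus (f x))%:E)].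

(* Every function is measurable for the discrete sigma-algebra. *)
Definition Lp p : set (X -> R[i]) := [set f | (Lp_norm p f < +oo)%E].

(* An operator defined on L^p is represented by a total map on functions, of
   which only the values on [Lp p] matter. *)
Definition linear_on_Lp p T : Prop :=
  forall (a : R[i]) f g, Lp p f -> Lp p g ->
    T (a *: f + g) = a *: T f + T g.

Definition weak_type p q T (C : R) : Prop :=
  forall f, Lp p f -> forall lambda : R, 0 < lambda ->
    (@counting X R [set x | (lambda < modulus (T f x))%R]
       <= (C%:E * Lp_norm p f * (lambda^-1)%:E) `^ q)%E.

Definition bounded_Lp p T : Prop :=
  (forall f, Lp p f -> Lp p (T f)) /\
  exists M : R, forall f, Lp p f -> (Lp_norm p (T f) <= M%:E * Lp_norm p f)%E.

Definition opnorm_Lp p T : \bar R :=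
  ereal_sup
    [set Lp_norm p (T f) | f in [set f | Lp p f /\ (Lp_norm p f <= 1)%E]].

End LpCounting.

(* Main.v *)
(* For the counting measure the weak type inequality says that the nth largest
   value of |T f| is at most A n^(-1/q), where A = C ||f||_p.  Hence
     ||T f||_p^p <= A^p sum_n n^(-p/q) <= A^p (1 + int_1^oo t^(-p/q) dt)
                  = A^p p / (p - q),
   which is the claimed bound without the factor 2^((p-q)/p) >= 1. *)
Require Import Defs.
From mathcomp Require Import all_boot all_order all_algebra.
From mathcomp Require Import finmap.
From mathcomp Require Import all_classical all_reals all_analysis.
From mathcomp Require Import complex.
From mathcomp Require Import ring lra.
Import Order.TTheory GRing.Theory Num.Theory.
Set Implicit Arguments.
Unset Strict Implicit.
Unset Printing Implicit Defensive.
Local Open Scope classical_set_scope.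
Local Open Scope ring_scope.

Lemma integral_counting_seq (R : realType) (X : pointedType) (f : X -> R)
    (s : seq X) : (forall x, 0 <= f x) -> uniq s ->
  (\int[@counting (vertices X) R]_(x in [set` s]) (f x)%:E =
    (\sum_(x <- s) f x)%:E)%E.
Proof.
move=> f0; elim: s => [_|x s IHs /andP[xs us]].
  by rewrite set_nil integral_set0 big_nil.
have -> : [set` x :: s] = [set x] `|` [set` s].
  by apply/seteqP; split=> y /=; rewrite inE => /predU1P.
rewrite ge0_integral_setU//; last 2 first.
- by move=> y _; rewrite lee_fin.
- by apply/disj_set2P; apply/seteqP; split=> // y [/= -> ys]; rewrite ys in xs.
rewrite (IHs us) big_cons EFinD; congr (_ + _)%E.
rewrite (eq_integral (cst (f x)%:E)); last by move=> y /[!inE] /= ->.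
by rewrite integral_cst//= /counting asboolT// fset_set1 cardfs1 mule1.
Qed.

(** The bound on finite sums makes every superlevel set [F n] finite. These sets increase to the
    support of [f], outside which the integrand vanishes, so monotone convergence writes the
    integral as a limit of finite sums. *)
Lemma integral_counting_le (R : realType) (X : pointedType) (f : X -> R)
    (M : R) : (forall x, 0 <= f x) ->
  (forall s : seq X, uniq s -> \sum_(x <- s) f x <= M) ->
  (\int[@counting (vertices X) R]_x (f x)%:E <= M%:E)%E.
Proof.
move=> f0 fM; pose F n := [set x : vertices X | n.+1%:R^-1 < f x].
have finF n : finite_set (F n).
  apply: contrapT => infF.
  (* This many points, more than [M * n.+1] of them, each contributing at least [n.+1%:R^-1], push
     the sum beyond [M]. *)
  have [B BF cB] := infinite_set_fset (Num.truncn (M * n.+1%:R)).+1 infF.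
  have := fM B (fset_uniq B); apply/negP; rewrite -ltNge.
  apply: (@lt_le_trans _ _ (\sum_(x <- B) n.+1%:R^-1)); last first.
    by rewrite !big_seq; apply: ler_sum => x xB; exact/ltW/BF.
  rewrite big_const_seq count_predT iter_addr_0 -[_ *+ _]mulr_natr mulrC.
  rewrite ltr_pdivlMr ?ltr0n//.
  by apply: lt_le_trans (truncnS_gt _) _; rewrite ler_nat.
have nndF : nondecreasing_seq F.
  move=> m n mn; apply/subsetPset => x /=; apply: le_lt_trans.
  by rewrite lef_pV2 ?posrE ?ltr0n// ler_nat.
have UF : \bigcup_n F n = [set x | 0 < f x].
  apply/seteqP; split=> x /=; first by case=> n _; apply: lt_trans.
  move=> fx; exists (Num.truncn (f x)^-1) => //=.
  by rewrite /F /= invf_plt ?posrE// truncnS_gt.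
have -> : (\int[@counting (vertices X) R]_x (f x)%:E =
    \int[@counting (vertices X) R]_(x in \bigcup_n F n) (f x)%:E)%E.
  rewrite [RHS]integral_mkcond; apply: eq_integral => x _.
  rewrite UF patchE; case: ifPn => //; rewrite notin_setE /= => /negP.
  by rewrite -leNgt => fx; congr EFin; apply/eqP; rewrite eq_le fx f0.
have cF := @ge0_nondecreasing_set_cvg_integral _ _ _ F (EFin \o f)
  (@counting (vertices X) R) nndF (fun=> I) (fun _ _ _ _ => I)
  (fun _ x _ => f0 x).
rewrite -(cvg_lim _ cF)//; apply: lime_le; first exact: cvgP cF.
apply: nearW => n; have [B ->] := finite_fsetP.1 (finF n).
by rewrite (integral_counting_seq f0 (fset_uniq B)) lee_fin fM// fset_uniq.
Qed.

(** The right-hand side is the integral of (s - 1) t^(-s) over [n + 1, n + 2], and the left-hand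
    side is the least value of that decreasing integrand on this interval of length 1. *)
Lemma powRN_le_diff (R : realType) (s : R) (n : nat) : 1 < s ->
  (s - 1) * n.+2%:R `^ (- s) <= n.+1%:R `^ (1 - s) - n.+2%:R `^ (1 - s).
Proof.
move=> s1; set a : R := n.+1%:R; set b : R := n.+2%:R.
have a0 : 0 < a by rewrite ltr0n.
have b0 : 0 < b by rewrite ltr0n.
have ab : a = b - 1 by rewrite /a /b -[n.+2]addn1 natrD addrK.
have -> : b `^ (- s) = b `^ (1 - s) / b.
  rewrite -[X in _ / X]powRr1 ?ltW// -powRB; last first.
    by rewrite [b == 0]gt_eqF ?implybT.
  by congr (_ `^ _); lra.
have -> : a `^ (1 - s) = b `^ (1 - s) * (a / b) `^ (1 - s).
  by rewrite -powRM ?divr_ge0 ?ltW// mulrC divfK ?gt_eqF.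
set u := b `^ (1 - s); have u0 : 0 <= u by exact: powR_ge0.
(* With the factor [u] removed, a Bernoulli inequality for a / b = 1 - 1/b remains. It follows from
   exp x >= 1 + x at x = (1 - s) ln(a / b), together with ln(1 - 1/b) <= -1/b. *)
suff : 1 + (s - 1) / b <= (a / b) `^ (1 - s).
  move=> /(ler_wpM2l u0); rewrite mulrDr mulr1 -lerBrDl mulrA mulrCA mulrA.
  by rewrite (mulrC u).
rewrite /powR gt_eqF ?divr_gt0//; apply: le_trans (expR_ge1Dx _).
rewrite lerD2l -[1 - s]opprB mulNr -mulrN ler_pM2l ?subr_gt0// lerNr.
have -> : a / b = 1 + - b^-1 by rewrite ab mulrBl divff ?gt_eqF// mul1r.
by apply: le_ln1Dx; rewrite ltrN2 invf_lt1// ltr1n.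
Qed.

(* Comparison of [\sum_k k^(-s)] with [1 + \int_1^oo t^(-s) dt = s / (s - 1)]. *)
Lemma sum_powRN_le (R : realType) (s : R) (n : nat) : 1 < s ->
  \sum_(0 <= k < n) k.+1%:R `^ (- s) <= s / (s - 1).
Proof.
move=> s1; have s10 : 0 < s - 1 by rewrite subr_gt0.
case: n => [|n]; first by rewrite big_nil divr_ge0 ?ltW// (lt_trans ltr01).
(* Keeping the subtracted power, which is (s - 1) times the integral of t^(-s) from n + 1 to
   infinity, makes the induction telescope. It is dropped at the end. *)
suff : (s - 1) * \sum_(0 <= k < n.+1) k.+1%:R `^ (- s) <=
    s - n.+1%:R `^ (1 - s).
  rewrite ler_pdivlMr// mulrC => /le_trans; apply.
  by rewrite gerBl powR_ge0.
elim: n => [|n IHn]; first by rewrite big_nat1 !powR1 mulr1.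
rewrite big_nat_recr//= mulrDr; have := powRN_le_diff n s1; lra.
Qed.

Lemma seq_argmin (R : realDomainType) (T : eqType) (g : T -> R) (s : seq T) :
  (0 < size s)%N -> exists2 x, x \in s & {in s, forall y, g x <= g y}.
Proof.
case: s => // x s _; elim: s x => [|y s IHs] x.
  by exists x; rewrite ?mem_head// => y /[1!inE] /eqP ->.
have [z zs zmin] := IHs y.
have [xz|/ltW zx] := leP (g x) (g z).
  exists x; rewrite ?mem_head// => w /[1!inE] /predU1P[->//|/zmin].
  exact: le_trans.
exists z; first by rewrite inE zs orbT.
by move=> w /[1!inE] /predU1P[->//|/zmin].
Qed.

(* The hypothesis says that the [n]th largest value of [g] is at most
   [A n^(-1/q)]. *)
Lemma sum_powR_le (R : realType) (T : eqType) (g : T -> R) (A p q : R)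
    (s : seq T) :
  0 < q -> q < p -> (forall x, 0 <= g x) -> 0 <= A ->
  (forall (u : seq T) (m : R), uniq u -> 0 < m -> {in u, forall x, m <= g x} ->
     (size u)%:R `^ q^-1 * m <= A) ->
  uniq s -> \sum_(x <- s) g x `^ p <= A `^ p * (p / (p - q)).
Proof.
move=> q0 qp g0 A0 gA us; have p0 := lt_trans q0 qp.
have -> : p / (p - q) = (p / q) / (p / q - 1).
  by field; rewrite gt_eqF// mulN1r subr_eq0 gt_eqF.
have pq1 : 1 < p / q by rewrite ltr_pdivlMr// mul1r.
apply: (@le_trans _ _
    (A `^ p * \sum_(0 <= k < size s) k.+1%:R `^ (- (p / q)))); last first.
  by rewrite ler_wpM2l ?powR_ge0// sum_powRN_le.
have [n sn] := ubnP (size s); elim: n s us sn => // n IHn s us sn.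
have [s_eq0|s_gt0] := posnP (size s).
  by rewrite (size0nil s_eq0) !big_nil mulr0.
have [x xs xmin] := seq_argmin g s_gt0.
have sE : size s = (size (rem x s)).+1 by rewrite size_rem// prednK.
rewrite (perm_big _ (perm_to_rem xs)) big_cons sE/= addrC.
rewrite big_nat_recr//= mulrDr lerD//.
  by apply: IHn; [exact: rem_uniq|rewrite -ltnS -sE].
(* The hypothesis covers only positive levels [m], so a zero minimum is treated apart. *)
have [->|gx_neq0] := eqVneq (g x) 0.
  by rewrite powR0 ?gt_eqF// mulr_ge0 ?powR_ge0.
have gx_gt0 : 0 < g x by rewrite lt_neqAle eq_sym gx_neq0 g0.
have gxA := gA s (g x) us gx_gt0 xmin.
rewrite -sE powRN ler_pdivlMr ?powR_gt0 ?ltr0n// mulrC (mulrC p) powRrM.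
rewrite -powRM ?powR_ge0// ge0_ler_powR ?nnegrE ?(ltW p0)//.
by rewrite mulr_ge0 ?powR_ge0.
Qed.

Lemma modulus_ge0 (R : realType) (z : R[i]) : 0 <= modulus z.
Proof. by case: z => x y; exact: sqrtr_ge0. Qed.

Lemma Lp_norm_le (R : realType) (X : pointedType) (p M : R) (f : X -> R[i]) :
  0 < p -> 0 <= M ->
  (forall s : seq X, uniq s -> \sum_(x <- s) modulus (f x) `^ p <= M `^ p) ->
  (Lp_norm p f <= M%:E)%E.
Proof.
move=> p0 M0 fM; rewrite /Lp_norm unlock /Lnorm.
have -> : M = (M `^ p) `^ p^-1 by rewrite -powRrM divff ?gt_eqF// powRr1.
rewrite -poweR_EFin; apply: gt0_ler_poweR.
- by rewrite invr_ge0 ltW.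
- by rewrite in_itv/= leey andbT integral_ge0//= => x _; exact: poweR_ge0.
- by rewrite in_itv/= lee_fin powR_ge0 leey.
under eq_integral do rewrite abse_EFin ger0_norm ?modulus_ge0// poweR_EFin.
by apply: integral_counting_le => // x; exact: powR_ge0.
Qed.

Lemma counting_ge_size (R : realType) (X : choiceType) (s : seq X) (A : set X) :
  uniq s -> [set` s] `<=` A -> ((size s)%:R%:E <= @counting X R A)%E.
Proof.
move=> us sA; rewrite /counting; case: ifPn => [/asboolP finA|_]; last first.
  exact: leey.
rewrite lee_fin ler_nat uniq_leq_size// => x xs.
by rewrite in_fset_set// inE; exact: sA.
Qed.

(** If |T f| >= m at k distinct points, the weak type inequality yields k <= (C N / m)^q with N the
    norm of [f], that is k^(1/q) m <= C N. This is the hypothesis of [sum_powR_le] with A = C N. *)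
Lemma weak_type_Lp_norm_le (R : realType) (X : pointedType) (p q C : R)
    (T : (X -> R[i]) -> (X -> R[i])) (f : X -> R[i]) :
  0 < q -> q < p -> 0 <= C -> weak_type p q T C -> Lp p f ->
  (Lp_norm p (T f) <= (C * (p / (p - q)) `^ p^-1)%:E * Lp_norm p f)%E.
Proof.
move=> q0 qp C0 weakT Lf; have p0 := lt_trans q0 qp.
have pq0 : 0 <= p / (p - q) by rewrite divr_ge0 ?subr_ge0 ?ltW.
have N0 : (0 <= Lp_norm p f)%E by exact: Lnorm_ge0.
have Nfin : Lp_norm p f \is a fin_num by rewrite ge0_fin_numE.
have := weakT f Lf; move: N0; rewrite -(fineK Nfin).
set N := fine _; rewrite lee_fin => N0 weakf.
rewrite -EFinM; apply: Lp_norm_le => //; first by rewrite !mulr_ge0 ?powR_ge0.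
move=> s us; have -> : (C * (p / (p - q)) `^ p^-1 * N) `^ p =
    (C * N) `^ p * (p / (p - q)).
  rewrite mulrAC (@powRM _ (C * N)) ?powR_ge0 ?mulr_ge0//.
  by rewrite -powRrM mulVf ?gt_eqF// powRr1.
apply: (sum_powR_le q0 qp) => //.
- by move=> x; exact: modulus_ge0.
- by rewrite mulr_ge0.
move=> u m uu m0 um; rewrite leNgt; apply/negP => lt_CN.
have k0 : 0 <= (size u)%:R `^ q^-1 :> R by exact: powR_ge0.
(* The weak type inequality concerns strict superlevel sets, whereas points of [u] may attain the
   value [m]. The strict inequality [lt_CN] leaves room for a lower level [l], halfway between C N /
   k^(1/q) and m, where k is the size of [u]. *)
have : exists2 l, 0 < l < m & C * N < (size u)%:R `^ q^-1 * l.
  have k_gt0 : 0 < (size u)%:R `^ q^-1 :> R.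
    rewrite lt_neqAle k0 eq_sym andbT; apply/eqP => k_eq0.
    by move: lt_CN; rewrite k_eq0 mul0r ltNge mulr_ge0.
  have [] := midf_lt (_ : C * N / (size u)%:R `^ q^-1 < m).
    by rewrite ltr_pdivrMr// [ltRHS]mulrC.
  set l := (_ + m) / 2 => lt_l lt_m; exists l.
    by rewrite lt_m andbT (le_lt_trans _ lt_l)// divr_ge0// mulr_ge0.
  by rewrite [ltRHS]mulrC -ltr_pdivrMr.
case=> l /andP[l0 lm]; apply/negP; rewrite -leNgt.
have := le_trans (counting_ge_size R uu _) (weakf l l0).
have sub : [set` u] `<=` [set x | l < modulus (T f x)].
  by move=> x /um; exact: lt_le_trans.
move=> /(_ sub); rewrite -!EFinM poweR_EFin lee_fin.
(* Taking q-th roots of k <= (C N / l)^q contradicts the choice of [l]. *)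
move=> /(@ge0_ler_powR _ q^-1); rewrite invr_ge0 (ltW q0) !nnegrE.
rewrite ler0n powR_ge0 -powRrM divff ?gt_eqF// powRr1; last first.
  by rewrite !mulr_ge0// invr_ge0 ltW.
by move=> /(_ isT isT isT); rewrite ler_pdivlMr.
Qed.

Theorem theorem4p2 (R : realType) (X : pointedType) (adj : rel X) (kappa : nat)
    (hkappa : (2 <= kappa)%N) (htree : homogeneous_tree adj kappa)
    (p q : R) (hq : 1 <= q) (hpq : q < p)
    (T : (X -> R[i]) -> (X -> R[i])) (hT : linear_on_Lp p T)
    (C : R) (hC : 0 < C) (hweak : weak_type p q T C) :
  bounded_Lp p T /\
  (opnorm_Lp p T <=
     (2 `^ ((p - q) / p) * C * (p / (p - q)) `^ (1 / p))%:E)%E.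
Proof.
have q0 : 0 < q := lt_le_trans ltr01 hq.
have bound f := weak_type_Lp_norm_le (f := f) q0 hpq (ltW hC) hweak.
have K0 : 0 <= C * (p / (p - q)) `^ p^-1 by rewrite mulr_ge0 ?powR_ge0 ?ltW.
split; first split=> [f Lf|].
- rewrite /Lp /= (le_lt_trans (bound f Lf))//.
  by rewrite ltey_eq fin_numM// ge0_fin_numE ?Lnorm_ge0.
- by exists (C * (p / (p - q)) `^ p^-1).
apply: ge_ereal_sup => _ [f [Lf f1] <-]; apply: (le_trans (bound f Lf)).
apply: (le_trans (lee_wpmul2l _ f1)); first by rewrite lee_fin.
rewrite mule1 lee_fin div1r -mulrA ler_peMl//.
(* The constant obtained so far is the claimed one without this power of 2, which is at least 1
   because its exponent is nonnegative. *)
have : 2 `^ 0 <= 2 `^ ((p - q) / p) :> R.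
  by rewrite ler_powR ?ler1n// divr_ge0 ?subr_ge0 ?ltW// (lt_trans q0).
by rewrite powRr0.
Qed.
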